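(* Let $M,D,K\in\mathbb{R}^{n\times n}$ with $D=\alpha M+\beta K$ for some scalars $\alpha,\beta\in\mathbb{R}$, let $B\in\mathbb{R}^{n\times m}$, $\mathscr{C}\in\mathbb{R}^{n\times q}$, and put $A(s)=s^2M+sD+K$ and $H(s)=\mathscr{C}^TA(s)^{-1}B$. Assume that $\|A(s)^{-1}B\|_{H_\infty}$, $\|\mathscr{C}^TA(s)^{-1}\|_{H_2}$ and $\|H\|_{H_2}$ are finite and $\|H\|_{H_2}\neq 0$. Consider an inexact AIRGA run (as defined in the context) on $(M,D,K,B,\mathscr{C})$ with real expansion points $\sigma_1,\dots,\sigma_J$, computed solution blocks $\tilde X_1,\dots,\tilde X_J$, residuals $\eta_{(0)},\dots,\eta_{(J-1)}$ and normalized blocks $\tilde V_1,\dots,\tilde V_J$, and set $\mathbf{X}=[\tilde X_1,\dots,\tilde X_J]$ and $\eta=[-\eta_{(0)},\dots,-\eta_{(J-1)}]$. Suppose that: (a) the linear systems are solved by a Ritz-Galerkin based solver, so that each residual is orthogonal to the subspace in which the corresponding solution was sought, i.e. $\tilde V_j^T\eta_{(j-1)}=0$ for $j=1,\dots,J$; (b) the extra orthogonalities $$\tilde V_i^T\eta_{(j-1)}=0\quad\text{for all }1\le i<j\le J,\qquad\text{and}\qquad \tilde V_i^T\eta_{(j-1)}=0\quad\text{for all }1\le j<i\le J$$ hold; (c) $A(s)$ is invertible (for every $s$ on the imaginary axis and at every expansion point $\sigma_j$) and $\|A(s)^{-1}\|_{H_\infty}<1$; (d) there exists $Z\in\mathbb{R}^{n\times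 n}$ with $Z\,\mathbf{X}=\eta$, and $\|Z\|_2<1$. Then the AIRGA algorithm is backward stable with respect to the inexact linear solves. That is, with the perturbed full system $(M,D,K+Z,B,\mathscr{C})$ and its transfer function $\tilde H(s)=\mathscr{C}^T\left(s^2M+sD+(K+Z)\right)^{-1}B$: (i) $\tilde f(H)=f(\tilde H)$, i.e. the reduced system produced by the inexact run on $(M,D,K,B,\mathscr{C})$ equals the reduced system produced by an exact AIRGA run on $(M,D,K+Z,B,\mathscr{C})$ with the same expansion points $\sigma_1,\dots,\sigma_J$; and (ii) $$\frac{\|H-\tilde H\|_{H_2}}{\|H\|_{H_2}}=\mathcal{O}(\|Z\|_2),$$ meaning that the left-hand side is at most $c\,\|Z\|_2$ for a constant $c$ depending only on $(M,D,K,B,\mathscr{C})$ (not on the run, its residuals, or $Z$).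
   Context: A tuple $(M,D,K,B,\mathscr{C})$ represents the second-order dynamical system $M\ddot x(t)+D\dot x(t)+Kx(t)=Bu(t)$, $y(t)=\mathscr{C}^Tx(t)$. Norms. $\|\cdot\|_f$ is the Frobenius norm and $\|\cdot\|_2$ the spectral norm. For a matrix-valued rational function $G$ defined on the imaginary axis, $\|G\|_{H_\infty}=\sup_{\omega\in\mathbb{R}}\|G(\imath\omega)\|_2$ and $\|G\|_{H_2}=\left(\frac{1}{2\pi}\int_{-\infty}^{\infty}\|G(\imath\omega)\|_f^2\,d\omega\right)^{1/2}$. AIRGA run. AIRGA (Adaptive Iterative Rational Global Arnoldi) is a model order reduction algorithm; only one outer iteration step is considered, only the linear systems whose solutions enter the projection matrix are tracked, and the intermediate re-orthogonalizations (QR and Arnoldi steps, which only improve the basis) are ignored. Let $\sigma_1,\dots,\sigma_J\in\mathbb{R}$ be the sequence of (not necessarily distinct) expansion points chosen by the algorithm. The choice of expansion points is assumed to be the same whether the linear systems are solved exactly or inexactly. For $1\le j\le J$ let $p(j)$ be the largest index $t<j$ with $\sigma_t=\sigma_j$, and $p(j)=0$ if there is no such index. A run on a system $(M,D,K,B,\mathscr{C})$ with residuals $\eta_{(0)},\dots,\eta_{(J-1)}\in\mathbb{R}^{n\times m}$ consists of nonzero blocks $\tilde X_1,\dots,\tilde X_J\in\mathbb{R}^{n\times m}$ and $\tilde V_j=\tilde X_j/\|\tilde X_j\|_f$ such that, for $j=1,\dots,J$, $$\left(\sigma_j^2M+\sigma_jD+K\right)\tilde X_j=R_j+\eta_{(j-1)},\qquad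 R_j=\begin{cases}B,& p(j)=0,\\ -M\tilde V_{p(j)},& p(j)\ge 1.\end{cases}$$ With $\tilde V=[\tilde V_1,\dots,\tilde V_J]\in\mathbb{R}^{n\times mJ}$, the reduced system produced by the run is $$\left(\tilde V^TM\tilde V,\ \tilde V^TD\tilde V,\ \tilde V^TK\tilde V,\ \tilde V^TB,\ \mathscr{C}^T\tilde V\right).$$ The run is called exact if all residuals $\eta_{(j-1)}$ are zero (linear systems solved exactly), and inexact in general (linear systems solved by an iterative method, leaving residuals). A run on the perturbed system $(M,D,K+Z,B,\mathscr{C})$ is defined by the same equations with $K$ replaced by $K+Z$ and $M,D,B,\mathscr{C}$ unchanged. $f$ denotes the map from a full system to the reduced system produced by an exact run, and $\tilde f$ the map from a full system to the reduced system produced by the inexact run under consideration. Backward stability of the algorithm with respect to inexact linear solves means: $\tilde f(H)=f(\tilde H)$ for some perturbed full system $\tilde H$ with $\|H-\tilde H\|_{H_2}/\|H\|_{H_2}=\mathcal{O}(\|Z\|_2)$, where $Z$ is the perturbation. *)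

(* Defs.v *)
From HB Require Import structures.
From mathcomp Require Import all_boot all_order all_algebra.
From mathcomp Require Import complex.
From mathcomp Require Import all_classical all_reals all_analysis.

Set Implicit Arguments.
Unset Strict Implicit.
Unset Printing Implicit Defensive.

Import Order.TTheory GRing.Theory Num.Theory.
Import numFieldNormedType.Exports.

Local Open Scope ring_scope.
Local Open Scope classical_set_scope.

Section Norms.
Context {R : realType}.

Definition cplx_mx p q (A : 'M[R]_(p, q)) : 'M[R[i]]_(p, q) :=
  map_mx (real_complex R) A.

(* The library's norm on matrices is the entrywise maximum, hence the explicit
   definitions below. Real matrices are measured through [cplx_mx]. *)
Definition frob_norm p q (A : 'M[R[i]]_(p, q)) : R :=
  Num.sqrt (\sum_i \sum_j ComplexField.Normc.normc (A i j) ^+ 2).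

(* On column vectors [frob_norm] is the Euclidean norm, so this is the matrix
   norm induced by it; the closed unit ball (rather than the sphere) keeps the
   set nonempty when q = 0. *)
Definition spec_norm p q (A : 'M[R[i]]_(p, q)) : R :=
  sup [set frob_norm (A *m x) | x in [set x : 'cV[R[i]]_q | frob_norm x <= 1]].

Definition imag_axis (w : R) : R[i] := Complex 0 w.

Definition Hinf_norm p q (G : R[i] -> 'M[R[i]]_(p, q)) : \bar R :=
  ereal_sup [set (spec_norm (G (imag_axis w)))%:E | w in [set: R]].

Definition H2_norm p q (G : R[i] -> 'M[R[i]]_(p, q)) : \bar R :=
  sqrte (((2 * pi)^-1)%:E *
    \int[@lebesgue_measure R]_(w in [set: R])
      (frob_norm (G (imag_axis w)) ^+ 2)%:E)%E.

End Norms.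

(* s^2 M + s D + K; used over R at the expansion points and over R[i] on the
   imaginary axis. *)
Definition quad_pencil (F : comNzRingType) n (M D K : 'M[F]_n) (s : F) : 'M[F]_n :=
  s ^+ 2 *: M + s *: D + K.

Section Systems.
Context {R : realType}.
Variables (n m q : nat).
Implicit Types (M D K : 'M[R]_n) (B : 'M[R]_(n, m)) (C : 'M[R]_(n, q)).

Definition sys_pencil M D K (s : R[i]) : 'M[R[i]]_n :=
  quad_pencil (cplx_mx M) (cplx_mx D) (cplx_mx K) s.

Definition transfer M D K B C (s : R[i]) : 'M[R[i]]_(q, m) :=
  (cplx_mx C)^T *m invmx (sys_pencil M D K s) *m cplx_mx B.

End Systems.

(* Steps of a run are indexed from 0: [j : 'I_J] is the (j+1)-st step, so that
   [eta j] is the residual with subscript (j). *)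
Section AIRGA.
Context {R : realType}.
Variables (n m q J : nat).
Implicit Types (M D K : 'M[R]_n) (B : 'M[R]_(n, m)) (C : 'M[R]_(n, q)).
Implicit Types (sigma : 'I_J -> R) (eta X V : 'I_J -> 'M[R]_(n, m)).

(* The last step before j with the same expansion point, if there is one. *)
Definition prev_step sigma (j : 'I_J) : option 'I_J :=
  [pick t : 'I_J | [&& (t < j)%N, sigma t == sigma j &
     [forall u : 'I_J, (t < u < j)%N ==> (sigma u != sigma j)]]].

Definition normalize X (j : 'I_J) : 'M[R]_(n, m) :=
  (frob_norm (cplx_mx (X j)))^-1 *: X j.

Definition airga_rhs M B sigma V (j : 'I_J) : 'M[R]_(n, m) :=
  if prev_step sigma j is Some t then - (M *m V t) else B.

Definition airga_run M D K B sigma eta X : Prop :=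
  forall j : 'I_J, X j != 0 /\
    quad_pencil M D K (sigma j) *m X j
    = airga_rhs M B sigma (normalize X) j + eta j.

Definition exact_airga_run M D K B sigma X : Prop :=
  airga_run M D K B sigma (fun=> 0) X.

(* [V_1, ..., V_J]; its width m * J is represented as \sum_(j < J) m. *)
Definition blocks V : 'M[R]_(n, \sum_(j < J) m) := \mxrow_(j < J) V j.

Definition reduced_system M D K B C X :
    'M[R]_(\sum_(j < J) m) * 'M[R]_(\sum_(j < J) m) * 'M[R]_(\sum_(j < J) m) *
    'M[R]_(\sum_(j < J) m, m) * 'M[R]_(q, \sum_(j < J) m) :=
  let V := blocks (normalize X) in
  (V^T *m M *m V, V^T *m D *m V, V^T *m K *m V, V^T *m B, C^T *m V).

End AIRGA.

(* Main.v *)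
(* Since Z X_j = - eta_j, the computed blocks X_j solve the systems of the run on
   (M, D, K + Z, B, C) exactly, and the orthogonalities give V^T Z V = 0, so
   both reduced systems agree. For the error, on the imaginary axis let
   W = (A + Z)^-1 B. Then W = A^-1 B - A^-1 Z W, whence
   |W|_2 <= |A^-1 B|_2 / (1 - |A^-1|_2 |Z|_2), and H - H~ = (C^T A^-1) Z W has
   Frobenius norm at most |C^T A^-1|_f |Z|_2 |W|_2; integrating yields the
   bound. *)
Require Import Defs.
From HB Require Import structures.
From mathcomp Require Import all_boot all_order all_algebra.
From mathcomp Require Import complex.
From mathcomp Require Import all_classical all_reals all_analysis.
From mathcomp Require Import ring lra.

Set Implicit Arguments.
Unset Strict Implicit.
Unset Printing Implicit Defensive.

Import Order.TTheory GRing.Theory Num.Theory.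
Import numFieldNormedType.Exports.

Local Open Scope ring_scope.
Local Open Scope classical_set_scope.

(** Lagrange's identity: the nonnegative double sum of [(a i * b j - a j * b i) ^+ 2] is twice the
    difference of the two sides. *)
Lemma cauchy_schwarz_sum (R : realDomainType) (I : finType) (a b : I -> R) :
  (\sum_i a i * b i) ^+ 2 <= (\sum_i a i ^+ 2) * (\sum_i b i ^+ 2).
Proof.
have : 0 <= \sum_i \sum_j (a i * b j - a j * b i) ^+ 2.
  by apply: sumr_ge0 => i _; apply: sumr_ge0 => j _; exact: sqr_ge0.
have -> : \sum_i \sum_j (a i * b j - a j * b i) ^+ 2 =
    \sum_i \sum_j a i ^+ 2 * b j ^+ 2 + \sum_i \sum_j b i ^+ 2 * a j ^+ 2
    - 2 * \sum_i \sum_j (a i * b i) * (a j * b j).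
  rewrite mulr_sumr -big_split /= -sumrB; apply: eq_bigr => i _.
  rewrite mulr_sumr -big_split /= -sumrB; apply: eq_bigr => j _; ring.
rewrite expr2 !big_distrlr /=.
rewrite [X in _ + X - _]exchange_big /=.
under [X in _ + X - _]eq_bigr do under eq_bigr do rewrite mulrC.
lra.
Qed.

(** * The Frobenius norm of complex matrices *)

Section FrobeniusNorm.
Context {R : realType}.
Local Notation normc := ComplexField.Normc.normc.

Lemma frob_norm_ge0 p q (A : 'M[R[i]]_(p, q)) : 0 <= frob_norm A.
Proof. exact: sqrtr_ge0. Qed.

Lemma frob_norm_sqr p q (A : 'M[R[i]]_(p, q)) :
  frob_norm A ^+ 2 = \sum_i \sum_j normc (A i j) ^+ 2.
Proof.
by rewrite sqr_sqrtr// sumr_ge0// => i _; rewrite sumr_ge0// => j _; exact: sqr_ge0.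
Qed.

(** A single sum over index pairs is the shape that [cauchy_schwarz_sum] takes. *)
Lemma frob_norm_sqr_pair p q (A : 'M[R[i]]_(p, q)) :
  frob_norm A ^+ 2 = \sum_(ij : 'I_p * 'I_q) normc (A ij.1 ij.2) ^+ 2.
Proof. by rewrite frob_norm_sqr pair_big. Qed.

Lemma normc_ge0 (z : R[i]) : 0 <= normc z.
Proof. by case: z => a b; exact: sqrtr_ge0. Qed.

Lemma normc0E : normc (0 : R[i]) = 0.
Proof. exact: ComplexField.Normc.normc0. Qed.

Lemma normc_sum (I : finType) (f : I -> R[i]) :
  normc (\sum_i f i) <= \sum_i normc (f i).
Proof.
apply: (big_ind2 (fun x y => normc x <= y)) => //; first by rewrite normc0E.
by move=> x1 x2 y1 y2 h1 h2; apply: le_trans (le_normcD _ _) _; exact: lerD.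
Qed.

Lemma frob_norm0 p q : frob_norm (0 : 'M[R[i]]_(p, q)) = 0.
Proof.
rewrite /frob_norm big1 ?sqrtr0// => i _; rewrite big1// => j _.
by rewrite mxE normc0E expr0n.
Qed.

Lemma frob_norm_eq0 p q (A : 'M[R[i]]_(p, q)) : frob_norm A = 0 -> A = 0.
Proof.
move=> A0; have /eqP : \sum_(ij : 'I_p * 'I_q) normc (A ij.1 ij.2) ^+ 2 = 0.
  by rewrite -frob_norm_sqr_pair A0 expr0n.
rewrite psumr_eq0 => [/allP/= h|ij _]; last exact: sqr_ge0.
apply/matrixP => i j; rewrite mxE; apply: ComplexField.Normc.eq0_normc.
by apply/eqP; have := h (i, j) (mem_index_enum _); rewrite /= expf_eq0.
Qed.

Lemma frob_normZ p q (r : R) (A : 'M[R[i]]_(p, q)) :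
  0 <= r -> frob_norm (r%:C%C *: A) = r * frob_norm A.
Proof.
move=> r0; apply/eqP.
rewrite -(eqrXn2 (n := 2))// ?mulr_ge0 ?frob_norm_ge0// exprMn !frob_norm_sqr_pair.
rewrite mulr_sumr; apply/eqP; apply: eq_bigr => ij _.
rewrite mxE ComplexField.Normc.normcM exprMn /= expr0n addr0.
by rewrite sqrtr_sqr ger0_norm.
Qed.

Lemma frob_normD p q (A B : 'M[R[i]]_(p, q)) :
  frob_norm (A + B) <= frob_norm A + frob_norm B.
Proof.
rewrite -ler_sqr ?nnegrE ?addr_ge0 ?frob_norm_ge0//.
set a := fun ij : 'I_p * 'I_q => normc (A ij.1 ij.2).
set b := fun ij : 'I_p * 'I_q => normc (B ij.1 ij.2).
have ab0 ij : 0 <= a ij + b ij by rewrite addr_ge0 ?normc_ge0.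
have le_ab : frob_norm (A + B) ^+ 2 <= \sum_ij (a ij + b ij) ^+ 2.
  rewrite frob_norm_sqr_pair; apply: ler_sum => ij _.
  by rewrite ler_sqr ?nnegrE ?normc_ge0// mxE le_normcD.
apply: le_trans le_ab _.
have -> : \sum_ij (a ij + b ij) ^+ 2 =
    \sum_ij a ij ^+ 2 + \sum_ij b ij ^+ 2 + 2 * \sum_ij a ij * b ij.
  by rewrite mulr_sumr -!big_split /=; apply: eq_bigr => ij _; ring.
rewrite -[\sum_ij a ij ^+ 2]frob_norm_sqr_pair.
rewrite -[\sum_ij b ij ^+ 2]frob_norm_sqr_pair.
(* Cauchy-Schwarz bounds the cross term of the expanded square. *)
have : \sum_ij a ij * b ij <= frob_norm A * frob_norm B.
  rewrite -ler_sqr ?nnegrE ?mulr_ge0 ?frob_norm_ge0//; last first.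
    by apply: sumr_ge0 => ij _; rewrite mulr_ge0 ?normc_ge0.
  by rewrite exprMn !frob_norm_sqr_pair; exact: cauchy_schwarz_sum.
rewrite sqrrD; lra.
Qed.

Lemma frob_normN p q (A : 'M[R[i]]_(p, q)) : frob_norm (- A) = frob_norm A.
Proof.
congr Num.sqrt; apply: eq_bigr => i _; apply: eq_bigr => j _.
by rewrite mxE normcN.
Qed.

(** Each entry of the product pairs a row of [A] with a column of [B]; Cauchy-Schwarz bounds its
    square, and the bounds sum to the product of the squared norms. *)
Lemma frob_normM p q r (A : 'M[R[i]]_(p, q)) (B : 'M[R[i]]_(q, r)) :
  frob_norm (A *m B) <= frob_norm A * frob_norm B.
Proof.
rewrite -ler_sqr ?nnegrE ?mulr_ge0 ?frob_norm_ge0// exprMn !frob_norm_sqr.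
rewrite [X in _ <= _ * X]exchange_big big_distrlr /=.
apply: ler_sum => i _; apply: ler_sum => j _; rewrite mxE.
apply: le_trans (cauchy_schwarz_sum _ _).
rewrite ler_sqr ?nnegrE ?normc_ge0//; last first.
  by apply: sumr_ge0 => k _; rewrite mulr_ge0 ?normc_ge0.
apply: le_trans (normc_sum _) _; apply: ler_sum => k _.
by rewrite ComplexField.Normc.normcM.
Qed.

(** The trace is the sum of [A i j * B j i] over all pairs, so this is Cauchy-Schwarz on the
    entries. *)
Lemma normc_mxtrace_mul p q (A : 'M[R[i]]_(p, q)) (B : 'M[R[i]]_(q, p)) :
  normc (\tr (A *m B)) <= frob_norm A * frob_norm B.
Proof.
rewrite -ler_sqr ?nnegrE ?mulr_ge0 ?normc_ge0 ?frob_norm_ge0// exprMn.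
rewrite frob_norm_sqr_pair [X in _ <= _ * X]frob_norm_sqr exchange_big pair_big /=.
apply: le_trans (cauchy_schwarz_sum _ _).
rewrite ler_sqr ?nnegrE ?normc_ge0//; last first.
  by apply: sumr_ge0 => k _; rewrite mulr_ge0 ?normc_ge0.
rewrite /mxtrace; under eq_bigr do rewrite mxE.
rewrite pair_big /=.
apply: le_trans (normc_sum _) _; apply: ler_sum => k _.
by rewrite ComplexField.Normc.normcM.
Qed.

Lemma frob_norm_conjtr p q (A : 'M[R[i]]_(p, q)) :
  frob_norm (map_mx conjc A^T) = frob_norm A.
Proof.
congr Num.sqrt; rewrite exchange_big /=.
apply: eq_bigr => i _; apply: eq_bigr => j _.
by rewrite !mxE; case: (A i j) => a b /=; rewrite sqrrN.
Qed.

Lemma mxtrace_mul_conjtr p q (A : 'M[R[i]]_(p, q)) :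
  \tr (A *m map_mx conjc A^T) = (frob_norm A ^+ 2)%:C%C.
Proof.
rewrite frob_norm_sqr rmorph_sum /=; apply: eq_bigr => i _.
rewrite mxE rmorph_sum /=; apply: eq_bigr => j _; rewrite !mxE -sqr_normc.
by rewrite normc_def -rmorphXn; case: (A i j).
Qed.

End FrobeniusNorm.

(** * The spectral norm and mixed bounds with the Frobenius norm *)

Section SpectralNorm.
Context {R : realType}.

(** Makes the [sup] in [spec_norm] a genuine supremum; the Frobenius norm of [A] is the bound. *)
Lemma spec_norm_has_ubound p q (A : 'M[R[i]]_(p, q)) :
  has_ubound
    [set frob_norm (A *m x) | x in [set x : 'cV[R[i]]_q | frob_norm x <= 1]].
Proof.
exists (frob_norm A) => _ [x /= x1 <-].
apply: le_trans (frob_normM _ _) _.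
by rewrite ler_piMr ?frob_norm_ge0.
Qed.

Lemma spec_norm_ge0 p q (A : 'M[R[i]]_(p, q)) : 0 <= spec_norm A.
Proof.
apply: (ub_le_sup (spec_norm_has_ubound A)).
by exists 0; rewrite /= ?mulmx0 frob_norm0 ?ler01.
Qed.

Lemma spec_norm_le p q (A : 'M[R[i]]_(p, q)) (c : R) : 0 <= c ->
  (forall x : 'cV_q, frob_norm (A *m x) <= c * frob_norm x) ->
  spec_norm A <= c.
Proof.
move=> c0 hA; apply: ge_sup.
  by exists 0, 0; rewrite /= ?mulmx0 frob_norm0 ?ler01.
by move=> _ [x /= x1 <-]; apply: le_trans (hA x) _; rewrite ler_piMr.
Qed.

Lemma frob_norm_mul_spec_col p q (A : 'M[R[i]]_(p, q)) (x : 'cV_q) :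
  frob_norm (A *m x) <= spec_norm A * frob_norm x.
Proof.
have [x0|x0] := eqVneq (frob_norm x) 0.
  by rewrite (frob_norm_eq0 x0) mulmx0 !frob_norm0 mulr0.
have xgt0 : 0 < frob_norm x by rewrite lt_neqAle eq_sym x0 frob_norm_ge0.
(* A nonzero [x] is rescaled to unit length, which puts it in the ball of the supremum. *)
rewrite -ler_pdivrMr// mulrC.
have ix0 : 0 <= (frob_norm x)^-1 by rewrite invr_ge0 ltW.
rewrite -frob_normZ// scalemxAr.
apply: (ub_le_sup (spec_norm_has_ubound A)).
by exists (((frob_norm x)^-1)%:C%C *: x) => //=; rewrite frob_normZ// mulVf.
Qed.

(** The squared Frobenius norm is the sum over columns, and [A] acts on each column separately. *)
Lemma frob_norm_mul_specl p q r (A : 'M[R[i]]_(p, q)) (X : 'M[R[i]]_(q, r)) :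
  frob_norm (A *m X) <= spec_norm A * frob_norm X.
Proof.
have frob_col s (Y : 'M[R[i]]_(s, r)) :
    frob_norm Y ^+ 2 = \sum_j frob_norm (col j Y) ^+ 2.
  rewrite frob_norm_sqr exchange_big; apply: eq_bigr => j _.
  by rewrite frob_norm_sqr; apply: eq_bigr => i _; rewrite big_ord1 mxE.
rewrite -ler_sqr ?nnegrE ?mulr_ge0 ?spec_norm_ge0 ?frob_norm_ge0//.
rewrite exprMn !frob_col mulr_sumr; apply: ler_sum => j _.
rewrite -exprMn ler_sqr ?nnegrE ?mulr_ge0 ?spec_norm_ge0 ?frob_norm_ge0//.
have -> : col j (A *m X) = A *m col j X.
  by apply/matrixP => i k; rewrite !mxE; apply: eq_bigr => l _; rewrite mxE.
exact: frob_norm_mul_spec_col.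
Qed.

(* With P the conjugate transpose of GN, |GN|_f^2 = tr(G (N P)) is at most
   |G|_f |N|_2 |P|_f, and |P|_f = |GN|_f. *)
Lemma frob_norm_mul_specr p q r (G : 'M[R[i]]_(p, q)) (N : 'M[R[i]]_(q, r)) :
  frob_norm (G *m N) <= frob_norm G * spec_norm N.
Proof.
have [->|GN0] := eqVneq (frob_norm (G *m N)) 0.
  by rewrite mulr_ge0 ?spec_norm_ge0 ?frob_norm_ge0.
have GN_gt0 : 0 < frob_norm (G *m N).
  by rewrite lt_neqAle eq_sym GN0 frob_norm_ge0.
rewrite -(ler_pM2r GN_gt0) -expr2.
set P := map_mx conjc (G *m N)^T.
have -> : frob_norm (G *m N) ^+ 2 = ComplexField.Normc.normc (\tr (G *m (N *m P))).
  rewrite mulmxA mxtrace_mul_conjtr /= expr0n addr0 sqrtr_sqr.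
  by rewrite ger0_norm// sqr_ge0.
apply: le_trans (normc_mxtrace_mul _ _) _; rewrite -mulrA.
apply: ler_wpM2l (frob_norm_ge0 _) _ _ _.
by rewrite -[frob_norm (G *m N)]frob_norm_conjtr frob_norm_mul_specl.
Qed.

End SpectralNorm.

(** * Inverse of a perturbed matrix *)

Section Perturbation.
Context {R : realType} {n : nat}.
Variables A Z : 'M[R[i]]_n.
Hypothesis Aunit : A \in unitmx.
Hypothesis AZ1 : spec_norm (invmx A) * spec_norm Z < 1.

(** A kernel vector satisfies [v = - A^-1 Z v], so it would be strictly shorter than itself unless
    it is zero. *)
Lemma unitmx_perturb : A + Z \in unitmx.
Proof.
(* Row freeness tests left kernels; transposing first turns this into a test on column vectors. *)
rewrite -unitmx_tr -row_free_unit; apply: inj_row_free => v vAZ.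
apply: trmx_inj; rewrite trmx0.
have /(congr1 (mulmx (invmx A))) : (A + Z) *m v^T = 0.
  by apply: trmx_inj; rewrite trmx_mul trmxK vAZ trmx0.
rewrite mulmx0 mulmxDl mulmxDr mulKmx// => /eqP; rewrite addr_eq0 => /eqP vE.
apply: frob_norm_eq0; apply/eqP; rewrite eq_le frob_norm_ge0 andbT leNgt.
apply/negP => v0; suff : frob_norm v^T < frob_norm v^T by rewrite ltxx.
rewrite {1}vE frob_normN.
apply: le_lt_trans (frob_norm_mul_specl _ _) _.
apply: (@le_lt_trans _ _ (spec_norm (invmx A) * spec_norm Z * frob_norm v^T)).
  by rewrite -mulrA ler_wpM2l ?spec_norm_ge0 ?frob_norm_mul_specl.
by rewrite gtr_pMl.
Qed.

Lemma resolvent_identity m (B : 'M[R[i]]_(n, m)) :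
  invmx A *m B - invmx (A + Z) *m B
  = invmx A *m Z *m (invmx (A + Z) *m B).
Proof.
(* The first [B] is written as [(A + Z) (A + Z)^-1 B]. *)
rewrite -{1}[B](mulKVmx unitmx_perturb) mulmxDl mulmxDr mulKmx//.
by rewrite addrAC subrr add0r -[RHS]mulmxA.
Qed.

Lemma spec_norm_resolvent m (B : 'M[R[i]]_(n, m)) :
  spec_norm (invmx (A + Z) *m B)
  <= spec_norm (invmx A *m B) / (1 - spec_norm (invmx A) * spec_norm Z).
Proof.
have d0 : 0 < 1 - spec_norm (invmx A) * spec_norm Z by rewrite subr_gt0.
apply: spec_norm_le; first by rewrite divr_ge0 ?spec_norm_ge0 ?ltW.
move=> x; rewrite mulrAC ler_pdivlMr//.
set W := _ *m B; set b := spec_norm (_ *m B).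
have WE : W *m x = invmx A *m B *m x - invmx A *m (Z *m (W *m x)).
  apply/eqP; rewrite eq_sym subr_eq addrC -subr_eq -mulmxBl.
  by rewrite resolvent_identity !mulmxA.
have leW : frob_norm (W *m x) <= b * frob_norm x +
    spec_norm (invmx A) * (spec_norm Z * frob_norm (W *m x)).
  rewrite {1}WE; apply: le_trans (frob_normD _ _) _; rewrite frob_normN.
  apply: lerD; first exact: frob_norm_mul_specl.
  apply: le_trans (frob_norm_mul_specl _ _) _.
  by rewrite ler_wpM2l ?spec_norm_ge0 ?frob_norm_mul_specl.
(* The term containing [W *m x] on the right of [leW] is absorbed into the left side. *)
by rewrite mulrBr mulr1 lerBlDr [X in _ + X]mulrC -mulrA.
Qed.

End Perturbation.

(** * Comparison of H2 and H-infinity norms with pointwise bounds *)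

Section SystemNorms.
Context {R : realType}.
Local Open Scope ereal_scope.
Import HBNNSimple.

(* No measurability is assumed: the integral of a nonnegative function is the
   supremum of the integrals of the simple functions below it. *)
Lemma ge0_integral_le_scale d (T : measurableType d)
    (mu : {measure set T -> \bar R}) (f g : T -> \bar R) (k : R) :
  (0 <= k)%R -> (forall x, 0 <= f x) -> (forall x, 0 <= g x) ->
  (forall x, f x <= k%:E * g x) ->
  \int[mu]_x f x <= k%:E * \int[mu]_x g x.
Proof.
rewrite le_eqVlt => /predU1P[<-|k0] f0 g0 fg.
  rewrite mul0e integral0_eq// => x _; apply/eqP; rewrite eq_le f0 andbT.
  by have := fg x; rewrite mul0e.
rewrite (ge0_integralTE _ f0); apply: ge_ereal_sup => _ [h /= hf <-].
have ik0 : (0 <= k^-1)%R by rewrite invr_ge0 ltW.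
pose h' := scale_nnsfun h ik0.
rewrite -lee_pdivrMl// -sintegralrM (ge0_integralTE _ g0).
apply: ereal_sup_ubound; exists h' => //= x.
by rewrite EFinM lee_pdivrMl// (le_trans (hf x)).
Qed.

Lemma H2_norm_le_scale p q p' q' (F : R[i] -> 'M[R[i]]_(p, q))
    (G : R[i] -> 'M[R[i]]_(p', q')) (k : R) :
  (0 <= k)%R ->
  (forall w, (frob_norm (F (imag_axis w)) <= k * frob_norm (G (imag_axis w)))%R) ->
  H2_norm F <= k%:E * H2_norm G.
Proof.
move=> k0 FG.
have pi0 : 0 <= ((2 * pi)^-1)%:E :> \bar R.
  by rewrite lee_fin invr_ge0 mulr_ge0// pi_ge0.
have sq0 p1 q1 (E : R[i] -> 'M[R[i]]_(p1, q1)) w :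
    0 <= (frob_norm (E (imag_axis w)) ^+ 2)%:E by rewrite lee_fin sqr_ge0.
(* Moving [k] under the root as its square reduces the claim to a comparison of integrals. *)
have -> : k%:E = sqrte (k ^+ 2)%:E by rewrite /= sqrtr_sqr ger0_norm.
rewrite /H2_norm -sqrteM ?lee_fin ?sqr_ge0// lee_sqrt; last first.
  by rewrite mule_ge0 ?lee_fin ?sqr_ge0// mule_ge0// integral_ge0.
rewrite muleCA lee_wpmul2l// ge0_integral_le_scale ?sqr_ge0// => w.
rewrite -EFinM lee_fin -exprMn ler_sqr ?nnegrE ?FG ?frob_norm_ge0//.
by rewrite mulr_ge0 ?frob_norm_ge0.
Qed.

Lemma H2_norm_ge0 p q (F : R[i] -> 'M[R[i]]_(p, q)) : 0 <= H2_norm F.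
Proof. exact: sqrte_ge0. Qed.

(** Finiteness ensures that [fine] returns the supremum itself and not its default value. *)
Lemma spec_norm_le_Hinf p q (F : R[i] -> 'M[R[i]]_(p, q)) :
  Hinf_norm F < +oo ->
  forall w, (spec_norm (F (imag_axis w)) <= fine (Hinf_norm F))%R.
Proof.
move=> Foo w.
have le_sup : (spec_norm (F (imag_axis w)))%:E <= Hinf_norm F.
  by apply: ereal_sup_ubound; exists w.
rewrite -lee_fin fineK// ge0_fin_numE//.
by apply: le_trans le_sup; rewrite lee_fin spec_norm_ge0.
Qed.

End SystemNorms.

(** * Inexact runs as exact runs on the perturbed system *)

Section Run.
Context {R : realType} {n m J : nat}.
Variables (M D K Z : 'M[R]_n) (B : 'M[R]_(n, m)) (sigma : 'I_J -> R).
Variables eta X : 'I_J -> 'M[R]_(n, m).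
Hypothesis run : airga_run M D K B sigma eta X.
Hypothesis ZX : Z *m blocks X = blocks (fun j => - eta j).

Let ZXj j : Z *m X j = - eta j.
Proof. by move: ZX; rewrite /blocks mul_mxrow => /eq_mxrowP/(_ j). Qed.

(** Adding [Z *m X j = - eta j] to a step cancels its residual. The right-hand sides do not involve
    [K], so they are unchanged. *)
Lemma inexact_run_exact : exact_airga_run M D (K + Z) B sigma X.
Proof.
move=> j; have [Xj0 runj] := run j; split => //.
rewrite addr0 /quad_pencil addrA mulmxDl ZXj.
by move: runj; rewrite /quad_pencil => ->; rewrite addrK.
Qed.

(** Only the stiffness component can differ, by [V^T Z V]; its block (i, j) is a multiple of
    [(normalize X i)^T *m eta j]. *)
Lemma reduced_system_perturb q (C : 'M[R]_(n, q)) :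
  (forall i j, (normalize X i)^T *m eta j = 0) ->
  reduced_system M D K B C X = reduced_system M D (K + Z) B C X.
Proof.
move=> orth; rewrite /reduced_system mulmxDr mulmxDl -[_ *m Z *m _]mulmxA.
suff -> : (blocks (normalize X))^T *m (Z *m blocks (normalize X)) = 0.
  by rewrite addr0.
rewrite /blocks mul_mxrow tr_mxrow mul_mxcol_mxrow -mxblock0; apply: eq_mxblock => i j.
by rewrite /normalize -scalemxAr ZXj -scalemxAr mulmxN orth oppr0 scaler0.
Qed.

End Run.

(** * Backward stability *)

Lemma sys_pencil_perturb (R : realType) n (M D K Z : 'M[R]_n) s :
  sys_pencil M D (K + Z) s = sys_pencil M D K s + cplx_mx Z.
Proof. by rewrite /sys_pencil /quad_pencil /cplx_mx map_mxD addrA. Qed.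

(** Quantifying [c] before the run and [Z] makes it depend on the system alone. The second
    conclusion guarantees that [invmx] in the perturbed transfer function is a true inverse on the
    imaginary axis. *)
Theorem theorem2 (R : realType) (n m q : nat) (M D K : 'M[R]_n)
  (B : 'M[R]_(n, m)) (C : 'M[R]_(n, q)) (alpha beta : R)
  (hD : D = alpha *: M + beta *: K)
  (hAunit : forall w : R, sys_pencil M D K (imag_axis w) \in unitmx)
  (hAinf : (Hinf_norm (fun s => invmx (sys_pencil M D K s)) < 1)%E)
  (hABinf : (Hinf_norm (fun s => invmx (sys_pencil M D K s) *m cplx_mx B)
             < +oo)%E)
  (hCA2 : (H2_norm (fun s => (cplx_mx C)^T *m invmx (sys_pencil M D K s))
           < +oo)%E)
  (hH2 : (H2_norm (transfer M D K B C) < +oo)%E)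
  (hH20 : H2_norm (transfer M D K B C) <> 0%E) :
  exists c : R,
    forall (J : nat) (sigma : 'I_J -> R) (eta X : 'I_J -> 'M[R]_(n, m))
      (Z : 'M[R]_n),
      airga_run M D K B sigma eta X ->
      (forall j : 'I_J, quad_pencil M D K (sigma j) \in unitmx) ->
      (forall j : 'I_J, (normalize X j)^T *m eta j = 0) ->
      (forall i j : 'I_J, (i < j)%N -> (normalize X i)^T *m eta j = 0) ->
      (forall i j : 'I_J, (j < i)%N -> (normalize X i)^T *m eta j = 0) ->
      Z *m blocks X = blocks (fun j => - eta j) ->
      spec_norm (cplx_mx Z) < 1 ->
      [/\ exists X' : 'I_J -> 'M[R]_(n, m),
            exact_airga_run M D (K + Z) B sigma X' /\
            reduced_system M D K B C X = reduced_system M D (K + Z) B C X',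
          forall w : R, sys_pencil M D (K + Z) (imag_axis w) \in unitmx
        & (H2_norm (fun s => (transfer M D K B C s
                              - transfer M D (K + Z) B C s)%R)
           / H2_norm (transfer M D K B C)
           <= (c * spec_norm (cplx_mx Z))%:E)%E].
Proof.
pose a := fine (Hinf_norm (fun s => invmx (sys_pencil M D K s))).
pose b := fine (Hinf_norm (fun s => invmx (sys_pencil M D K s) *m cplx_mx B)).
pose g := fine (H2_norm (fun s => (cplx_mx C)^T *m invmx (sys_pencil M D K s))).
pose h := fine (H2_norm (transfer M D K B C)).
have leA : forall w, spec_norm (invmx (sys_pencil M D K (imag_axis w))) <= a.
  by apply: spec_norm_le_Hinf; exact: lt_le_trans hAinf (leey _).
have leAB : forall w,
    spec_norm (invmx (sys_pencil M D K (imag_axis w)) *m cplx_mx B) <= b.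
  exact: spec_norm_le_Hinf.
have a0 : 0 <= a by apply: le_trans (leA 0); exact: spec_norm_ge0.
have b0 : 0 <= b by apply: le_trans (leAB 0); exact: spec_norm_ge0.
have a1 : a < 1.
  rewrite -lte_fin fineK// fin_numElt (lt_trans hAinf (ltey _)) andbT.
  (* For [fine] to be faithful, minus infinity must be excluded as well: the supremum dominates the
     nonnegative value at frequency 0. *)
  apply: (@lt_le_trans _ _ 0%E) => //.
  apply: (@le_trans _ _
    (spec_norm (invmx (sys_pencil M D K (imag_axis 0))))%:E).
    by rewrite lee_fin spec_norm_ge0.
  by apply: ereal_sup_ubound; exists 0.
have gE : H2_norm (fun s => (cplx_mx C)^T *m invmx (sys_pencil M D K s)) = g%:E.
  by rewrite fineK// ge0_fin_numE ?H2_norm_ge0.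
have hE : H2_norm (transfer M D K B C) = h%:E.
  by rewrite fineK// ge0_fin_numE ?H2_norm_ge0.
have h0 : h != 0 by apply/eqP => h0; apply: hH20; rewrite hE h0.
have hge0 : 0 <= h by rewrite -lee_fin -hE H2_norm_ge0.
(* [b / (1 - a)] bounds the spectral norm of [(A + Z)^-1 B] along the axis, [g] is the H2 norm of
   [C^T A^-1], and [h] normalizes the error. *)
exists (b / (1 - a) * g / h).
move=> J sigma eta X Z run _ orth_eq orth_lt orth_gt ZX Z1.
set z := spec_norm (cplx_mx Z).
have z0 : 0 <= z by exact: spec_norm_ge0.
(* Since [z < 1], the bound [a] holds for every admissible [Z]; this keeps the constant independent
   of [Z]. *)
have leAZ w : spec_norm (invmx (sys_pencil M D K (imag_axis w))) * z <= a.
  by apply: le_trans (leA w); rewrite ler_piMr ?spec_norm_ge0// ltW.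
have AZ1 w : spec_norm (invmx (sys_pencil M D K (imag_axis w))) * z < 1.
  exact: le_lt_trans a1.
split.
(* The computed blocks themselves form the exact run; the three orthogonality hypotheses cover the
   three orderings of [i] and [j]. *)
- exists X; split; first exact: inexact_run_exact run ZX.
  apply: (reduced_system_perturb M D K B ZX C) => i j.
  by case: (ltngtP i j) => [/orth_lt|/orth_gt|/val_inj->].
- by move=> w; rewrite sys_pencil_perturb; exact: unitmx_perturb.
have k0 : 0 <= z * (b / (1 - a)).
  by rewrite mulr_ge0// divr_ge0// subr_ge0 ltW.
have hbound : (H2_norm (fun s => (transfer M D K B C s
                                  - transfer M D (K + Z) B C s)%R)
    <= (z * (b / (1 - a)) * g)%:E)%E.
  rewrite EFinM -gE; apply: H2_norm_le_scale => // w.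
  rewrite /transfer sys_pencil_perturb -!mulmxA -mulmxBr resolvent_identity//.
  set A := sys_pencil M D K (imag_axis w).
  rewrite !mulmxA -(mulmxA _ (invmx (A + _))).
  (* The error is [(C^T A^-1 Z) ((A + Z)^-1 B)]: the right factor is split off in spectral norm,
     then [Z] in the same way. *)
  apply: le_trans (frob_norm_mul_specr _ _) _; rewrite [leRHS]mulrC [leRHS]mulrA.
  apply: ler_pM; rewrite ?spec_norm_ge0 ?frob_norm_ge0//.
    exact: frob_norm_mul_specr.
  apply: le_trans (spec_norm_resolvent (hAunit w) (AZ1 w) _) _.
  apply: ler_pM; rewrite ?spec_norm_ge0 ?leAB ?invr_ge0 ?subr_ge0 ?(ltW (AZ1 w))//.
  by rewrite lef_pV2 ?posrE ?subr_gt0// lerD2l lerN2.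
(* As [h] is nonzero, the extended-real inverse is the ordinary one. *)
rewrite hE inver (negPf h0).
have -> : b / (1 - a) * g / h * z = z * (b / (1 - a)) * g * h^-1 by ring.
by rewrite [leRHS]EFinM lee_wpmul2r// lee_fin invr_ge0.
Qed.
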